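(* Consider an admixture model with $K$ topics, with vectors $\mathbf q,\mathbf s\in\mathbb R^K$, and $\Phi$ defined on $\mathcal D=\{\boldsymbol\theta\in\Delta^{K-1}:0<\mathbf q^\top\boldsymbol\theta<1\}$. Let $\mathbf M=[\mathbf 1,\mathbf q,\mathbf s]^\top\in\mathbb R^{3\times K}$, $\rho=\operatorname{rank}\mathbf M$, and for real $u,z$ let $\mathcal F_\Delta(u,z)=\{\boldsymbol\theta\in\Delta^{K-1}:\mathbf q^\top\boldsymbol\theta=u,\ \mathbf s^\top\boldsymbol\theta=z\}$. (i) For $u\in(0,1)$ with $\mathcal F_\Delta(u,z)\neq\emptyset$: $\mathcal F_\Delta(u,z)$ is a convex polytope on which $\Phi$ is constant; its affine hull has dimension at most $K-\rho$; and when $(u,z)$ is attained at a point of $\operatorname{relint}\Delta^{K-1}$ (i.e. $\mathcal F_\Delta(u,z)\cap\operatorname{relint}\Delta^{K-1}\ne\emptyset$), the polytope has dimension exactly $K-\rho$ (for $\rho=3$, exactly $K-3$). (ii) At any $\boldsymbol\theta\in\operatorname{relint}\Delta^{K-1}\cap\mathcal D$ with $g_e\mathbf q+g_\sigma\mathbf s\notin\operatorname{span}\{\mathbf 1\}$ (where $g_e,g_\sigma$ are evaluated at $(\mathbf q^\top\boldsymbol\theta,\mathbf s^\top\boldsymbol\theta)$), the level set of $\Phi$ in the simplex through $\boldsymbol\theta$ is, in a neighbourhood of $\boldsymbol\theta$, a smooth manifold of dimension $K-2$, with tangent space at $\boldsymbol\theta$ equal to $\{\boldsymbol\delta\in\mathbb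 R^K:\mathbf 1^\top\boldsymbol\delta=0,\ (g_e\mathbf q+g_\sigma\mathbf s)^\top\boldsymbol\delta=0\}$. (iii) If $\rho=3$: for any convex set $C\subset\mathcal D$ on which $\Phi$ is constant, the image of $C$ under $\boldsymbol\theta\mapsto(\mathbf q^\top\boldsymbol\theta,\mathbf s^\top\boldsymbol\theta)$ is a convex subset of a level curve of $g$ that is a strictly concave graph over $u\in(0,1)$, hence contains at most one point; so $C\subset\mathcal F_\Delta(u,z)$ for a single $(u,z)$. Consequently level sets of $\Phi$ contain no line segment along which $(\mathbf q^\top\boldsymbol\theta,\mathbf s^\top\boldsymbol\theta)$ is non-constant (no segment transverse to the fibres).
   Context: $\mathcal V$ is a finite word vocabulary, $\dashv$ is a sentence-boundary token, $\widetilde{\mathcal V}=\mathcal V\cup\{\dashv\}$, and $\mathrm{syl}:\mathcal V\to[1,s_{\max}]$ is a fixed bounded real-valued syllable count. $\Delta^{K-1}$ is the probability simplex in $\mathbb R^K$ and $\operatorname{relint}$ its relative interior (all coordinates positive). An admixture model is given by probability distributions $\boldsymbol\beta_1,\dots,\boldsymbol\beta_K$ on $\widetilde{\mathcal V}$, with $\pi_{\boldsymbol\theta}=\sum_k\theta_k\boldsymbol\beta_k$; set $q_k=\beta_{k\dashv}$, $s_k=\sum_{w\in\mathcal V}\beta_{kw}\,\mathrm{syl}(w)$, $\mathbf q=(q_k)_k$, $\mathbf s=(s_k)_k$. $\mathbf 1$ is the all-ones vector. Put $g(u,z)=a(1-u)/u+bz/(1-u)+c$ for $u\in(0,1)$,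 $z\in\mathbb R$, and $\Phi(\boldsymbol\theta)=g(\mathbf q^\top\boldsymbol\theta,\mathbf s^\top\boldsymbol\theta)$ for $\boldsymbol\theta\in\mathcal D$. $g_e,g_\sigma$ are the partial derivatives of $g$: at $(e,\sigma)$, $g_e=-\frac{a}{e^2}+\frac{b\sigma}{(1-e)^2}$, $g_\sigma=\frac{b}{1-e}$. The coefficients $(a,b,c)$ are fixed: $(0.39,11.8,-15.59)$ (Flesch–Kincaid Grade Level) or $(-1.015,-84.6,206.835)$ (Flesch Reading Ease). The sets $\mathcal F_\Delta(u,z)$ are called fibres. The level curve $\{g=v\}$ is regarded as a set of pairs $(u,z)$, $u\in(0,1)$, i.e. the graph of $z$ as a function of $u$. *)

(* Defs.v *)
From mathcomp Require Import all_boot all_order all_algebra.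
From mathcomp Require Import all_classical all_reals all_analysis.
From mathcomp Require Import ring.

Set Implicit Arguments.
Unset Strict Implicit.
Unset Printing Implicit Defensive.

Import Order.TTheory GRing.Theory Num.Theory.
Import numFieldNormedType.Exports.

Local Open Scope classical_set_scope.
Local Open Scope ring_scope.

Definition constant_on (T S : Type) (f : T -> S) (A : set T) : Prop :=
  exists v : S, forall x, A x -> f x = v.

Section AffineGeometry.
Context {R : realType} {E : vectType R}.
Implicit Types (A L : set E) (x y : E).

Definition segment_set x y : set E :=
  [set t *: x + (1 - t) *: y | t in [set t : R | 0 <= t <= 1]].

Definition conv_hull A : set E :=
  [set x | exists n (p : 'I_n -> E) (c : 'I_n -> R),
    [/\ forall i, A (p i), forall i, 0 <= c i,
        \sum_i c i = 1 & x = \sum_i c i *: p i]].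

Definition polytope A : Prop := exists2 S : set E, finite_set S & A = conv_hull S.

Definition aff_hull A : set E :=
  [set x | exists n (p : 'I_n -> E) (c : 'I_n -> R),
    [/\ forall i, A (p i), \sum_i c i = 1 & x = \sum_i c i *: p i]].

(* L is a translate of a d-dimensional linear subspace (in particular L is
   nonempty). *)
Definition affine_subspace_of_dim (d : nat) L : Prop :=
  exists (x : E) (V : {vspace E}),
    \dim V = d /\ L = [set x + v | v in [set v | v \in V]].

End AffineGeometry.

Section Smoothness.
Context {R : realType}.

Definition iter_derive {U V : normedModType R} (f : U -> V) (vs : seq U) : U -> V :=
  foldr (fun v h => 'D_v h) f vs.

(* C^oo on the open set W: all iterated directional derivatives exist and are
   continuous at every point of W. *)
Definition smooth_on {U V : normedModType R} (W : set U) (f : U -> V) : Prop :=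
  forall (vs : seq U) (x : U), W x ->
    {for x, continuous (iter_derive f vs)} /\
    forall v, derivable (iter_derive f vs) x v.

(* Every point of M has a neighbourhood in M diffeomorphic to an open subset W
   of R^d: phi is a smooth parametrization of M `&` U, and psi is a smooth
   extension to U of its inverse. *)
Definition smooth_submanifold {n : nat} (d : nat) (M : set 'cV[R]_n) : Prop :=
  forall x, M x ->
    exists (W : set 'cV[R]_d) (U : set 'cV[R]_n)
           (phi : 'cV[R]_d -> 'cV[R]_n) (psi : 'cV[R]_n -> 'cV[R]_d),
      [/\ open W, open U & U x] /\
      [/\ smooth_on W phi, smooth_on U psi, phi @` W = M `&` U &
          forall w, W w -> psi (phi w) = w].

(* Velocities at x of the smooth curves drawn on M. *)
Definition tangent_space {n : nat} (M : set 'cV[R]_n) (x : 'cV[R]_n) :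
    set 'cV[R]_n :=
  [set d | exists (I : set R^o) (gamma : R^o -> 'cV[R]_n),
    [/\ open I, I 0, smooth_on I gamma & forall t, I t -> M (gamma t)] /\
    gamma 0 = x /\ derive1 gamma 0 = d].

End Smoothness.

Definition strictly_concave_on {R : realType} (A : set R) (h : R -> R) : Prop :=
  forall x y t, A x -> A y -> x != y -> 0 < t < 1 ->
    t * h x + (1 - t) * h y < h (t * x + (1 - t) * y).

Definition strictly_concave_graph {R : realType} (A : set R) (S : set (R^o * R^o)) :
    Prop :=
  exists2 h : R -> R, strictly_concave_on A h & S = [set (u, h u) | u in A].

Section Simplex.
Context {R : realType} {K : nat}.

Definition dotv (x y : 'cV[R]_K) : R := (x^T *m y) 0 0.

Definition simplex : set 'cV[R]_K :=
  [set th | (forall k, 0 <= th k 0) /\ \sum_k th k 0 = 1].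

Definition relint_simplex : set 'cV[R]_K :=
  [set th | simplex th /\ forall k, 0 < th k 0].

End Simplex.

Section Admixture.
Context {R : realType} {V : finType} {K : nat}.

(* The extended vocabulary is [option V]: [None] is the sentence-boundary token
   and [Some w] is the word w. *)
Definition is_dist (p : option V -> R) : Prop :=
  (forall w, 0 <= p w) /\ \sum_w p w = 1.

Definition stop_vec (beta : 'I_K -> option V -> R) : 'cV[R]_K :=
  \col_k beta k None.

Definition syl_vec (syl : V -> R) (beta : 'I_K -> option V -> R) : 'cV[R]_K :=
  \col_k \sum_(w : V) beta k (Some w) * syl w.

End Admixture.

Section Readability.
Context {R : realType}.

Definition fkgl_coefs : R * R * R := (39 / 100, 118 / 10, - (1559 / 100)).

(* The constant term 206.835 is written 206 + 835/1000 to avoid a large unary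
   numeral. *)
Definition fre_coefs : R * R * R :=
  (- (1015 / 1000), - (846 / 10), 206 + 835 / 1000).

Definition gscore (a b c u z : R) : R := a * (1 - u) / u + b * z / (1 - u) + c.

Definition gscore_e (a b c e sigma : R) : R :=
  derive1 (fun u : R^o => gscore a b c u sigma : R^o) e.

Definition gscore_sigma (a b c e sigma : R) : R :=
  derive1 (fun z : R^o => gscore a b c e z : R^o) sigma.

Lemma gscore_eE (a b c e sigma : R) : 0 < e < 1 ->
  gscore_e a b c e sigma = - a / e ^+ 2 + b * sigma / (1 - e) ^+ 2.
Proof.
move=> /andP[e0 e1]; rewrite /gscore_e derive1E.
have e_neq0 : e != 0 by rewrite gt_eqF.
have e1_neq0 : 1 - e != 0 by rewrite subr_eq0 gt_eqF.
have d1 : is_derive (e : R^o) 1 (fun u : R^o => u^-1 : R^o) (- e ^- 2 *: 1).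
  exact: is_deriveV.
have d2 : is_derive (e : R^o) 1 (fun u : R^o => (1 - u)^-1 : R^o)
    (- (1 - e) ^- 2 *: (0 - 1)) by exact: is_deriveV.
rewrite derive_val /GRing.scale /=; field; exact/andP.
Qed.

Lemma gscore_sigmaE (a b c e sigma : R) :
  gscore_sigma a b c e sigma = b / (1 - e).
Proof.
rewrite /gscore_sigma derive1E derive_val /GRing.scale /=.
ring.
Qed.

Definition level_curve (a b c v : R) : set (R^o * R^o) :=
  [set p | 0 < p.1 < 1 /\ gscore a b c p.1 p.2 = v].

Context {K : nat}.
Implicit Types (q s th : 'cV[R]_K).

Definition moments q s th : R^o * R^o := (dotv q th, dotv s th).

Definition moment_matrix q s : 'M[R]_(1 + (1 + 1), K) :=
  (row_mx (const_mx 1 : 'cV[R]_K) (row_mx q s))^T.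

Definition fibre q s (u z : R) : set 'cV[R]_K :=
  [set th | [/\ simplex th, dotv q th = u & dotv s th = z]].

Definition score_dom q : set 'cV[R]_K :=
  [set th | simplex th /\ 0 < dotv q th < 1].

(* Only meaningful on [score_dom q]. *)
Definition score (a b c : R) q s th : R := gscore a b c (dotv q th) (dotv s th).

Definition score_level (a b c : R) q s (v : R) : set 'cV[R]_K :=
  [set th | score_dom q th /\ score a b c q s th = v].

End Readability.

(* Main.v *)
From HB Require Import structures.
Require Import Defs.
From mathcomp Require Import all_boot all_order all_algebra.
From mathcomp Require Import all_classical all_reals all_analysis.
From mathcomp Require Import ring lra.

Import Order.TTheory GRing.Theory Num.Theory.
Import numFieldNormedType.Exports.

Local Open Scope classical_set_scope.
Local Open Scope ring_scope.

(** Fibres are standard polyhedra [{x >= 0 | A x = b}]: they are the convex hull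
    of their points of minimal support, and their affine hull is the set of
    [x0 + d] with [A d = 0] and the support of [d] inside that of a point [x0] of
    maximal support.

    For fixed [v] the equation [g(u, z) = v] is [z = h(u)] with
    [h(u) = alpha + beta u - (a / b) / u], strictly concave since [a / b > 0]; this
    is all of (iii).  For (ii), the gradient [g_e q + g_sigma s] is a multiple of
    [nu = s - h'(u0) q], so that on the simplex the level set near [theta] is
    [nu . (x - theta) = r (q . (x - theta))] with [r] the remainder of [h] of
    order two at [u0].  Take [e] with [1 . e = 0] and [nu . e = 1], and moreover
    [q . e = 0] if [nu] is not in the span of [1] and [q]; otherwise [q] vanishes
    on [N = ker 1 /\ ker nu].  In both cases the level set is, near [theta], the
    graph [theta + w + r (q . w) e] of an explicit rational function of [w] in [N],
    and no implicit function theorem is needed. *)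

(** * Standard polyhedra and fibres *)

Section LinearAlgebra.
Context {R : realType}.

(** Transposition turns the row kernel of [A^T] into the column kernel of [A]. A row-free matrix has
    a right inverse, whose transpose [P] reads off coordinates in the basis [B]. *)
Lemma ker_basis_mx {m n : nat} (A : 'M[R]_(m, n)) :
  exists (B : 'M[R]_(n, n - \rank A)) (P : 'M[R]_(n - \rank A, n)),
    [/\ A *m B = 0, P *m B = 1%:M &
        forall x : 'cV[R]_n, A *m x = 0 -> B *m (P *m x) = x].
Proof.
have rk : \rank (kermx A^T) = (n - \rank A)%N by rewrite mxrank_ker mxrank_tr.
rewrite -rk; set C := row_base (kermx A^T).
have freeC : row_free C by rewrite row_base_free.
have AC : C *m A^T = 0 by apply/sub_kermxP; rewrite eq_row_base.
exists C^T, (pinvmx C)^T; split.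
- by apply: trmx_inj; rewrite trmx_mul trmxK AC trmx0.
- by rewrite -trmx_mul mulmxVp // trmx1.
- move=> x Ax; apply: trmx_inj; rewrite !trmx_mul !trmxK mulmxKpV //.
  by rewrite eq_row_base; apply/sub_kermxP; rewrite -trmx_mul Ax trmx0.
Qed.

Lemma ker_vspace {m n : nat} (A : 'M[R]_(m, n)) :
  exists2 V : {vspace 'cV[R]_n}, \dim V = (n - \rank A)%N &
    forall x, (x \in V) = (A *m x == 0).
Proof.
have [B [P [AB PB BP]]] := ker_basis_mx A.
pose f := linfun (mulmx B : 'cV[R]_(n - \rank A) -> 'cV[R]_n).
have fE x : f x = B *m x by rewrite lfunE.
exists (limg f) => [|x].
  rewrite limg_dim_eq ?dimvf ?dim_matrix; first exact: muln1.
  apply/eqP; rewrite -subv0; apply/subvP => x /memv_capP[_].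
  rewrite memv_ker fE memv0 => /eqP Bx.
  by rewrite -[x]mul1mx -PB -mulmxA Bx mulmx0.
apply/memv_imgP/eqP => [[y _ ->]|Ax].
  by rewrite fE mulmxA AB mul0mx.
by exists (P *m x); rewrite ?memvf // fE BP.
Qed.

End LinearAlgebra.

Section ConvexHull.
Context {R : realType} {E : vectType R}.

Lemma conv_hull_sub (A : set E) : A `<=` conv_hull A.
Proof.
move=> x Ax; exists 1%N, (fun=> x), (fun=> 1).
by rewrite !big_ord1 scale1r; split.
Qed.

(** The two families of points are concatenated, their weights scaled by [t] and [1 - t]. *)
Lemma conv_hull_combination (A : set E) (t : R) (x y : E) : 0 <= t <= 1 ->
  conv_hull A x -> conv_hull A y -> conv_hull A (t *: x + (1 - t) *: y).
Proof.
move=> /andP[t0 t1] [m [p [c [Ap c0 c1 ->]]]] [n [p' [c' [Ap' c'0 c'1 ->]]]].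
exists (m + n)%N,
  (fun i : 'I_(m + n) => match fintype.split i with inl j => p j | inr j => p' j end),
  (fun i : 'I_(m + n) => match fintype.split i with
            | inl j => t * c j | inr j => (1 - t) * c' j end).
have splitl (i : 'I_m) : fintype.split (lshift n i) = inl i := unsplitK (inl i).
have splitr (i : 'I_n) : fintype.split (rshift m i) = inr i := unsplitK (inr i).
split.
- by move=> i; case: (fintype.split i).
- by move=> i; case: (fintype.split i) => j; rewrite mulr_ge0 // subr_ge0.
- rewrite big_split_ord /=; under eq_bigr do rewrite splitl.
  under [X in _ + X]eq_bigr do rewrite splitr.
  by rewrite -!mulr_sumr c1 c'1 !mulr1 addrC subrK.
- rewrite big_split_ord /= !scaler_sumr; congr (_ + _).
    by apply: eq_bigr => i _; rewrite splitl scalerA.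
  by apply: eq_bigr => i _; rewrite splitr scalerA.
Qed.

End ConvexHull.

Section StandardPolyhedron.
Context {R : realType} {m n : nat} (A : 'M[R]_(m, n)) (b : 'cV[R]_m).
Implicit Types x y d : 'cV[R]_n.

Definition std_polyhedron : set 'cV[R]_n :=
  [set x | A *m x = b /\ forall k, 0 <= x k 0].

Definition support_set x : {set 'I_n} := [set k | x k 0 != 0].

Lemma support_sub0 x (S : {set 'I_n}) k :
  support_set x \subset S -> k \notin S -> x k 0 = 0.
Proof.
move=> /fintype.subsetP/(_ k) h kS; apply/eqP; apply: contraNT kS => xk.
by apply: h; rewrite inE.
Qed.

(** The ratio test of the simplex method: move along [d] until a first coordinate vanishes. The
    support condition keeps zero coordinates at zero and makes the step positive. *)
Lemma polyhedron_exit x d :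
  std_polyhedron x -> A *m d = 0 -> support_set d \subset support_set x ->
  (exists k, d k 0 < 0) ->
  exists2 t : R, 0 < t & std_polyhedron (x + t *: d) /\
    (support_set (x + t *: d) \proper support_set x).
Proof.
move=> [Ax x0] Ad sdx [k0 dk0].
have [k dk kmin] := @Order.TotalTheory.arg_minP _ _ _ k0
  (fun k => d k 0 < 0) (fun k => x k 0 / - d k 0) dk0.
have xpos j : d j 0 < 0 -> 0 < x j 0.
  move=> dj; rewrite lt0r x0 andbT; apply: contraTneq dj => xj.
  by rewrite (support_sub0 _ _ _ sdx) ?ltxx // inE xj eqxx.
have t0 : 0 < x k 0 / - d k 0 by rewrite divr_gt0 ?oppr_gt0 // xpos.
exists (x k 0 / - d k 0) => //; set t := _ / _ in t0 kmin *.
split; first split.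
- by rewrite mulmxDr -scalemxAr Ad scaler0 addr0.
- move=> j; rewrite !mxE; have [dj|dj] := ltP (d j 0) 0; last first.
    exact: addr_ge0 (x0 j) (mulr_ge0 (ltW t0) dj).
  have := kmin j dj; rewrite ler_pdivlMr ?oppr_gt0 // mulrN => h.
  by rewrite -lerBlDr sub0r.
- apply/properP; split.
    apply/fintype.subsetP => j; apply: contraLR => jx.
    have := jx; rewrite !inE !negbK !mxE => /eqP ->.
    by rewrite (support_sub0 _ _ _ sdx jx) mulr0 addr0.
  exists k; first by rewrite inE gt_eqF ?xpos.
  rewrite inE negbK !mxE.
  by rewrite /t invrN mulrN mulNr divfK ?subrr // lt_eqF.
Qed.

Lemma polyhedron_combination (I : finType) (p : I -> 'cV[R]_n) (c : I -> R) :
  (forall i, std_polyhedron (p i)) -> (forall i, 0 <= c i) ->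
  \sum_i c i = 1 -> std_polyhedron (\sum_i c i *: p i).
Proof.
move=> Pp c0 c1; split.
  rewrite mulmx_sumr (eq_bigr (fun i => c i *: b)) => [|i _].
    by rewrite -scaler_suml c1 scale1r.
  by rewrite -scalemxAr; have [-> _] := Pp i.
move=> k; rewrite summxE sumr_ge0 // => i _.
by rewrite !mxE mulr_ge0 //; have [_ ->] := Pp i.
Qed.

Hypothesis bounded : forall d, A *m d = 0 -> \sum_k d k 0 = 0.

(* The points of minimal support are the basic feasible solutions of linear
   programming; a point that is not minimal can be moved both ways along a line
   until its support drops. *)
Lemma std_polyhedron_polytope : polytope std_polyhedron.
Proof.
pose vert := [set x | std_polyhedron x /\ forall y, std_polyhedron y ->
  support_set y \subset support_set x -> y = x].
exists vert.
  (* By minimality a vertex is determined by its support, so [g] maps the finite type of supports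
     onto a set containing all vertices. *)
  pose g (S : {set 'I_n}) := xget 0 [set x | vert x /\ support_set x = S].
  apply: (@sub_finite_set _ _ (g @` setT)); last exact/finite_image/finite_finset.
  move=> x vx; exists (support_set x) => //.
  rewrite /g; case: xgetP => [y _ [[Py _] sxy]|/(_ x)]; last by case.
  by case: vx => _; apply=> //; rewrite sxy.
(* A nonnegative direction whose coordinates sum to zero vanishes; hence the line through [x] leaves
   the polyhedron both ways. *)
have neg_coord d : A *m d = 0 -> d != 0 -> exists k, d k 0 < 0.
  move=> Ad /eqP dn0; apply: contrapT => nd; apply: dn0.
  have d0 k : 0 <= d k 0 by rewrite leNgt; apply/negP => dk; apply: nd; exists k.
  have h := psumr_eq0P (fun k _ => d0 k) (bounded _ Ad).
  by apply/colP => k; rewrite h // mxE.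
apply/seteqP; split=> [x|x [N [p [c [vp c0 c1 ->]]]]]; last first.
  by apply: polyhedron_combination => // i; have [] := vp i.
have [N] := ubnP #|support_set x|; elim: N => // N IH in x * => xN Px.
have [vx|] := pselect (vert x); first exact: conv_hull_sub.
move=> /not_andP[//|/existsNP[y /not_implyP[Py /not_implyP[syx /eqP yx]]]].
have Ad : A *m (y - x) = 0.
  by have [[Ax _] [Ay _]] := (Px, Py); rewrite mulmxBr Ax Ay subrr.
have sd : support_set (y - x) \subset support_set x.
  apply/fintype.subsetP => k; apply: contraLR => kx.
  rewrite inE negbK !mxE (support_sub0 _ _ _ syx kx).
  by move: kx; rewrite inE negbK => /eqP ->; rewrite subrr.
have sNd : support_set (x - y) \subset support_set x.
  apply: fintype.subset_trans sd; apply/fintype.subsetP => k.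
  by rewrite !inE !mxE -opprB oppr_eq0.
have AN : A *m (x - y) = 0 by rewrite -opprB mulmxN Ad oppr0.
have [|t t0 [Pt st]] := polyhedron_exit x (y - x) Px Ad sd.
  by apply: neg_coord => //; rewrite subr_eq0.
have [|r r0 [Pr sr]] := polyhedron_exit x (x - y) Px AN sNd.
  by apply: neg_coord => //; rewrite subr_eq0 eq_sym.
have lt_card z : support_set z \proper support_set x -> (#|support_set z| < N)%N.
  by move=> /proper_card zx; apply: leq_trans zx _; rewrite -ltnS.
have tr : t + r != 0 by rewrite gt_eqF ?addr_gt0.
(* The weights [r / (t + r)] and [t / (t + r)] make the displacements [t] and [- r] along [y - x]
   cancel. *)
suff -> : x = r / (t + r) *: (x + t *: (y - x))
            + (1 - r / (t + r)) *: (x + r *: (x - y)).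
  apply: conv_hull_combination; [|exact: IH (lt_card _ st) Pt|exact: IH (lt_card _ sr) Pr].
  apply/andP; split; first by rewrite divr_ge0 ?addr_ge0 ?ltW.
  by rewrite ler_pdivrMr ?addr_gt0 // mul1r ler_wpDl // ltW.
by apply/colP => k; rewrite !mxE; field.
Qed.

End StandardPolyhedron.

(** * Affine hulls of standard polyhedra and their dimension *)

Section AffineHull.
Context {R : realType} {m n : nat} (A : 'M[R]_(m, n)) (b : 'cV[R]_m).
Local Notation P := (std_polyhedron A b).

(** Coordinates being nonnegative, nothing cancels in a midpoint: its support is the union of the
    two supports. So a support of largest cardinality contains all others. *)
Lemma std_polyhedron_max_support : P !=set0 ->
  exists2 x0, P x0 & forall y, P y -> support_set y \subset support_set x0.
Proof.
case=> p Pp.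
pose attained (S : {set 'I_n}) := `[< exists2 x, P x & support_set x = S >].
have attp : attained (support_set p) by apply/asboolP; exists p.
have [S /asboolP[x0 Px0 sx0] Smax] :=
  @Order.TotalTheory.arg_maxP _ _ _ (support_set p) attained (fun S => #|S|) attp.
exists x0 => // y Py.
pose z := 2^-1 *: x0 + (1 - 2^-1) *: y.
have half : 1 - 2^-1 = 2^-1 :> R by field.
have Pz : P z.
  have [[Ax x0p] [Ay y0]] := (Px0, Py); split.
    by rewrite mulmxDr -!scalemxAr Ax Ay -scalerDl subrKC scale1r.
  by move=> k; rewrite !mxE half addr_ge0 // mulr_ge0 // invr_ge0.
have zE k : (k \in support_set z) = (k \in support_set x0 :|: support_set y).
  have [[_ x0p] [_ y0]] := (Px0, Py).
  rewrite !inE !mxE half -mulrDr mulf_eq0 invr_eq0 pnatr_eq0 /=.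
  by rewrite paddr_eq0 // negb_and.
have /setP zE' : support_set z = support_set x0 :|: support_set y by apply/setP.
have /Smax : attained (support_set z) by apply/asboolP; exists z.
rewrite -sx0 => le_z.
have card_z : (#|support_set z| <= #|support_set x0|)%N := le_z.
have /eqP -> : support_set x0 == support_set z.
  by rewrite eqEcard card_z andbT; apply/fintype.subsetP => k kx; rewrite zE inE kx.
by apply/fintype.subsetP => k ky; rewrite zE inE ky orbT.
Qed.

(** The directions are the kernel vectors of [A] supported where [x0] is. A point with all
    coordinates positive forces the support of [x0] to be full, and the support condition
    disappears. *)
Lemma std_polyhedron_aff_hull : P !=set0 ->
  exists x0 (V : {vspace 'cV[R]_n}),
    [/\ aff_hull P = [set x0 + v | v in [set v | v \in V]],
        (\dim V <= n - \rank A)%N &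
        (exists2 x, P x & forall k, 0 < x k 0) -> \dim V = (n - \rank A)%N].
Proof.
move=> /std_polyhedron_max_support[x0 Px0 x0max].
(* [D] projects onto the coordinates outside the support of [x0]; stacking it under [A] turns the
   support condition into linear equations. *)
pose D : 'M[R]_n := diag_mx (\row_k (k \notin support_set x0)%:R).
have D0 d : D *m d = 0 <-> support_set d \subset support_set x0.
  split=> [Dd|sd].
    apply/fintype.subsetP => k; apply: contraLR => kx.
    have /(congr1 (fun M : 'cV[R]_n => M k 0)) := Dd.
    by rewrite mul_diag_mx !mxE kx mul1r inE negbK => ->.
  apply/colP => k; rewrite mul_diag_mx !mxE.
  have [kx|kx] := boolP (k \in support_set x0); first by rewrite mul0r.
  by rewrite (support_sub0 _ _ _ sd kx) mulr0.
have [V dimV VE] := ker_vspace (col_mx A D).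
have [W dimW WE] := ker_vspace A.
have VP d : d \in V <-> A *m d = 0 /\ support_set d \subset support_set x0.
  rewrite VE mul_col_mx col_mx_eq0; split=> [/andP[/eqP ? /eqP/D0]//|].
  by move=> [-> /D0 ->]; rewrite !eqxx.
exists x0, V; split.
- apply/seteqP; split=> [x [N [p [c [Pp c1 ->]]]]|x [d /VP[Ad sd] <-]].
    exists (\sum_i c i *: p i - x0); last by rewrite addrC subrK.
    have -> : \sum_i c i *: p i - x0 = \sum_i c i *: (p i - x0).
      under [RHS]eq_bigr do rewrite scalerBr.
      by rewrite sumrB -scaler_suml c1 scale1r.
    rewrite /= rpred_sum // => i _; apply: rpredZ; apply/VP.
    have [[Ax _] [Ap _]] := (Px0, Pp i).
    split; first by rewrite mulmxBr Ax Ap subrr.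
    apply/fintype.subsetP => k; apply: contraLR => kx.
    rewrite inE negbK !mxE (support_sub0 _ _ _ (x0max _ (Pp i)) kx).
    by move: kx; rewrite inE negbK => /eqP ->; rewrite subrr.
  have [t t0 Pt] : exists2 t : R, 0 < t & P (x0 + t *: d).
    have [nd|dge0] := pselect (exists k, d k 0 < 0).
      by have [t t0 [Pt _]] := polyhedron_exit _ _ _ _ Px0 Ad sd nd; exists t.
    exists 1 => //; have [Ax x0p] := Px0; split.
      by rewrite scale1r mulmxDr Ad addr0.
    move=> k; rewrite scale1r mxE addr_ge0 // leNgt; apply/negP => dk.
    by apply: dge0; exists k.
  (* [x0 + d] lies on the line through [x0] and [x0 + t d]; the weight [1 - t^-1] may be
     negative. *)
  exists 2%N, (fun i : 'I_2 => if i == 0 then x0 else x0 + t *: d),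
    (fun i : 'I_2 => if i == 0 then 1 - t^-1 else t^-1).
  rewrite !big_ord_recl !big_ord0 /=; split.
  + by move=> i; case: ifP.
  + by rewrite addr0 subrK.
  + apply/colP => k; rewrite !mxE; field; exact: lt0r_neq0.
- rewrite -dimW; apply: dimvS; apply/subvP => d /VP[Ad _].
  by rewrite WE Ad.
- move=> [x Px xpos]; rewrite -dimW; congr (\dim _).
  apply/vspaceP => d; apply/idP/idP => [/VP[Ad _]|]; first by rewrite WE Ad.
  rewrite WE => /eqP Ad; apply/VP; split=> //; apply/fintype.subsetP => k _.
  have /fintype.subsetP := x0max _ Px; apply.
  by rewrite inE gt_eqF.
Qed.

End AffineHull.

(** * Fibres as standard polyhedra *)

Section Fibre.
Context {R : realType} {K : nat}.
Implicit Types q s x y th : 'cV[R]_K.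

Lemma dotvE x y : dotv x y = \sum_k x k 0 * y k 0.
Proof. by rewrite /dotv mxE; apply: eq_bigr => k _; rewrite mxE. Qed.

Lemma dotv_is_linear x : linear (dotv x : 'cV[R]_K -> R^o).
Proof. by move=> t y z; rewrite /dotv mulmxDr -scalemxAr !mxE. Qed.

HB.instance Definition _ x :=
  GRing.isLinear.Build R 'cV[R]_K R^o _ (dotv x) (dotv_is_linear x).

Lemma dotvD x y z : dotv x (y + z) = dotv x y + dotv x z.
Proof. exact: (linearD (dotv x : {linear 'cV[R]_K -> R^o})). Qed.

Lemma dotvZ x t y : dotv x (t *: y) = t * dotv x y.
Proof. exact: (linearZ_LR (dotv x : {linear 'cV[R]_K -> R^o})). Qed.

Lemma dotvB x y z : dotv x (y - z) = dotv x y - dotv x z.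
Proof. exact: (linearB (dotv x : {linear 'cV[R]_K -> R^o})). Qed.

Lemma dotv0 x : dotv x 0 = 0.
Proof. exact: (linear0 (dotv x : {linear 'cV[R]_K -> R^o})). Qed.

Lemma dotvDl x y z : dotv (y + z) x = dotv y x + dotv z x.
Proof. by rewrite /dotv linearD mulmxDl mxE. Qed.

Lemma dotvZl x t y : dotv (t *: y) x = t * dotv y x.
Proof. by rewrite /dotv linearZ -scalemxAl mxE. Qed.

Lemma dotv1E x : dotv (const_mx 1) x = \sum_k x k 0.
Proof. by rewrite dotvE; apply: eq_bigr => k _; rewrite mxE mul1r. Qed.

Lemma moment_matrix_mul q s x : moment_matrix q s *m x =
  col_mx (dotv (const_mx 1) x)%:M (col_mx (dotv q x)%:M (dotv s x)%:M).
Proof.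
by rewrite /moment_matrix !tr_row_mx !mul_col_mx /dotv -!mx11_scalar.
Qed.

(** The row of ones in the moment matrix carries the normalization of the simplex; only
    nonnegativity remains. That same row later supplies the boundedness hypothesis. *)
Lemma fibre_std_polyhedron q s u z :
  fibre q s u z = std_polyhedron (moment_matrix q s) (col_mx 1 (col_mx u%:M z%:M)).
Proof.
have inj11 (x y : R) : x%:M = y%:M :> 'M[R]_1 -> x = y.
  by move=> /(congr1 (fun M : 'M[R]_1 => M 0 0)); rewrite !mxE !mulr1n.
apply/seteqP; split=> x; rewrite /std_polyhedron /= moment_matrix_mul dotv1E.
  by move=> [[x0 ->] -> ->].
by move=> [/eq_col_mx[/inj11 x1 /eq_col_mx[/inj11 ? /inj11 ?]] x0].
Qed.

Lemma fibre_polytope q s u z : polytope (fibre q s u z).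
Proof.
rewrite fibre_std_polyhedron; apply: std_polyhedron_polytope => d.
rewrite moment_matrix_mul => /eqP; rewrite !col_mx_eq0 => /andP[/eqP + _].
by move=> /(congr1 (fun M : 'M[R]_1 => M 0 0)); rewrite !mxE mulr1n dotv1E.
Qed.

Lemma fibre_aff_hull q s u z : fibre q s u z !=set0 ->
  (exists2 d, (d <= K - \rank (moment_matrix q s))%N &
     affine_subspace_of_dim d (aff_hull (fibre q s u z))) /\
  (fibre q s u z `&` relint_simplex !=set0 ->
     affine_subspace_of_dim (K - \rank (moment_matrix q s))
       (aff_hull (fibre q s u z))).
Proof.
rewrite fibre_std_polyhedron => /std_polyhedron_aff_hull[x0 [V [-> dimV dimVE]]].
split; first by exists (\dim V) => //; exists x0, V.
move=> [x [Px [_ xpos]]]; exists x0, V; split=> //; apply: dimVE.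
by exists x.
Qed.

End Fibre.

(** * Level curves of the score *)

Section LevelCurve.
Context {R : realType} (a b c v : R).
Implicit Types u z : R.

(** The equation [g(u, z) = v] solved for [z]. Since [(1 - u)^2 / u = 1 / u - 2 + u], it is affine
    in [u] up to the term [- (a / b) / u]. *)
Definition level_fun u : R := ((v - c) * (1 - u) - a * (1 - u) ^+ 2 / u) / b.

Lemma gscore_level u z : b != 0 -> 0 < u < 1 ->
  gscore a b c u z = v <-> z = level_fun u.
Proof.
move=> b0 /andP[u0 u1]; rewrite /gscore /level_fun.
have u_neq0 : u != 0 by rewrite gt_eqF.
have u1_neq0 : 1 - u != 0 by rewrite subr_eq0 gt_eqF.
split=> [<-|->]; field; exact/and3P.
Qed.

(** The affine part drops out of the concavity gap, and the gap of [1 / u] has a closed form with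
    the factor [(x - y)^2]. *)
Lemma level_fun_strictly_concave : 0 < a / b ->
  strictly_concave_on `]0, 1[ level_fun.
Proof.
move=> ab x y t; rewrite /= !in_itv /= => /andP[x0 _] /andP[y0 _] xy /andP[t0 t1].
(* Division by zero yields zero, so positivity of [a / b] excludes [b = 0]. *)
have b0 : b != 0 by apply: contraTneq ab => ->; rewrite invr0 mulr0 ltxx.
have t1' : 0 < 1 - t by rewrite subr_gt0.
have m0 : 0 < t * x + (1 - t) * y by rewrite addr_gt0 ?mulr_gt0.
rewrite -subr_gt0.
suff -> : level_fun (t * x + (1 - t) * y) - (t * level_fun x + (1 - t) * level_fun y)
    = a / b * (t * (1 - t) * (x - y) ^+ 2 / (x * y * (t * x + (1 - t) * y))).
  have xy2 : 0 < (x - y) ^+ 2 by rewrite exprn_even_gt0 //= subr_eq0.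
  by rewrite mulr_gt0 // divr_gt0 // mulr_gt0 // mulr_gt0.
rewrite /level_fun; field.
by rewrite b0 !gt_eqF.
Qed.

Lemma level_curve_strictly_concave : 0 < a / b ->
  strictly_concave_graph `]0, 1[ (level_curve a b c v).
Proof.
move=> ab; exists level_fun; first exact: level_fun_strictly_concave.
have b0 : b != 0 by apply: contraTneq ab => ->; rewrite invr0 mulr0 ltxx.
apply/seteqP; split=> [[u z] [/= u01 /gscore_level uz]|p [u]].
  by exists u; rewrite /= ?in_itv // uz.
by rewrite /= in_itv /= => u01 <-; split=> //; exact/gscore_level.
Qed.

End LevelCurve.

(** * Convex sets on which the score is constant *)

Section ConvexLevelSets.
Context {R : realType}.

Lemma convex_setP {E : lmodType R} (A : set (convex_lmodType E)) :
  convex_set A <-> forall (x y : E) (t : R), 0 <= t <= 1 -> A x -> A y ->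
    A (t *: x + (1 - t) *: y).
Proof.
split=> [cA x y t t01 Ax Ay|cA x y t /set_mem Ax /set_mem Ay].
  have t01' : Itv.spec (@Itv.num_sem R) (Itv.Real `[0%Z, 1%Z]) t.
    by rewrite /Itv.spec /= /Itv.num_sem /= num_real /= in_itv /= t01.
  by have := cA x y (Itv.mk t01') (mem_set Ax) (mem_set Ay) => /set_mem.
by apply/mem_set/cA => //; rewrite ge0 le1.
Qed.

Lemma segment_convex {E : vectType R} (x y : E) :
  convex_set (segment_set x y : set (convex_lmodType E)).
Proof.
apply/convex_setP => _ _ t /andP[t0 t1] [r /andP[r0 r1] <-] [w /andP[w0 w1] <-].
exists (t * r + (1 - t) * w) => /=.
  by apply/andP; split; nra.
rewrite !scalerDr !scalerA addrACA -!scalerDl.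
by congr (_ + _ *: _); ring.
Qed.

Context {K : nat} (a b c : R) (q s : 'cV[R]_K).
Hypothesis ab_gt0 : 0 < a / b.

(** If two points of [C] had different values of [q], their midpoint would lie in [C], hence on the
    level curve; as the moments are linear, it would also lie on the chord, against strict
    concavity. *)
Lemma convex_level_set_moments (C : set 'cV[R]_K) : convex_set C ->
  C `<=` score_dom q -> constant_on (score a b c q s) C ->
  [/\ convex_set (moments q s @` C),
      (exists2 v : R, moments q s @` C `<=` level_curve a b c v &
         strictly_concave_graph `]0, 1[ (level_curve a b c v)),
      is_subset1 (moments q s @` C) &
      exists u z : R, C `<=` fibre q s u z].
Proof.
move=> /convex_setP cC domC [v Cv].
have b0 : b != 0 by apply: contraTneq ab_gt0 => ->; rewrite invr0 mulr0 ltxx.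
have u01 x : C x -> 0 < dotv q x < 1 by move=> /domC[].
have zE x : C x -> dotv s x = level_fun a b c v (dotv q x).
  by move=> Cx; apply/(gscore_level a b c v); rewrite ?u01 //; exact: Cv.
have subs1 : is_subset1 (moments q s @` C).
  move=> _ _ [x Cx <-] [y Cy <-].
  suff qxy : dotv q x = dotv q y by rewrite /moments (zE x) // (zE y) // qxy.
  apply/eqP; apply: contraT => qxy.
  have half01 : 0 < (2^-1 : R) < 1 by apply/andP; split; lra.
  have Cm : C (2^-1 *: x + (1 - 2^-1) *: y).
    by apply: cC => //; apply/andP; split; lra.
  have : dotv q x \in `]0, 1[ by rewrite in_itv; exact: u01.
  have : dotv q y \in `]0, 1[ by rewrite in_itv; exact: u01.
  move=> hy hx.
  have := level_fun_strictly_concave a b c v ab_gt0 _ _ _ hx hy qxy half01.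
  by rewrite -zE // -zE // -!dotvZ -!dotvD -zE // ltxx.
split=> //.
- apply/convex_setP => _ _ t t01 [x Cx <-] [y Cy <-].
  exists (t *: x + (1 - t) *: y); first exact: cC.
  by rewrite /moments !dotvD !dotvZ.
- exists v; last exact: level_curve_strictly_concave.
  by move=> _ [x Cx <-]; split; [exact: u01|exact: Cv].
- have [[x Cx]|C0] := pselect (C !=set0); last first.
    (* For empty [C] any pair serves. *)
    by exists 0, 0 => x Cx; case: C0; exists x.
  exists (dotv q x), (dotv s x) => y Cy.
  have [qxy sxy] : moments q s x = moments q s y by apply: subs1; [exists x|exists y].
  by have [simy _] := domC _ Cy.
Qed.

Lemma segment_level_set_moments (v : R) (x y : 'cV[R]_K) :
  segment_set x y `<=` score_level a b c q s v ->
  constant_on (moments q s) (segment_set x y).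
Proof.
move=> sxy.
have [||_ _ _ [u [z uz]]] :=
    convex_level_set_moments _ (segment_convex x y).
- by move=> p /sxy[].
- by exists v => p /sxy[].
by exists (u, z) => p /uz[_ <- <-].
Qed.

End ConvexLevelSets.

(** * Smooth rational maps *)

Section Smooth.
Context {R : realType}.

Lemma differentiable_mulmx {m n : nat} (M : 'M[R]_(n, m)) (x : 'cV[R]_m) :
  differentiable (mulmx M : 'cV[R]_m -> 'cV[R]_n) x.
Proof.
have -> : (mulmx M : 'cV[R]_m -> 'cV[R]_n) = \sum_j (fun y : 'cV[R]_m => y j 0 *: col j M).
  apply/funext => y; rewrite fct_sumE; apply/colP => i.
  by rewrite mxE summxE; apply: eq_bigr => j _; rewrite !mxE mulrC.
by apply: differentiable_sum => j; apply: differentiableZl; exact: differentiable_coord.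
Qed.

Lemma continuous_mulmx {m n : nat} (M : 'M[R]_(n, m)) :
  continuous (mulmx M : 'cV[R]_m -> 'cV[R]_n).
Proof. by move=> x; exact/differentiable_continuous/differentiable_mulmx. Qed.

Lemma is_diff_mulmx {m n : nat} (M : 'M[R]_(n, m)) (x : 'cV[R]_m) :
  is_diff x (mulmx M : 'cV[R]_m -> 'cV[R]_n) (mulmx M).
Proof.
apply: DiffDef; first exact: differentiable_mulmx.
exact: (@diff_lin R 'cV[R]_m 'cV[R]_n (mulmx M) x (continuous_mulmx M)).
Qed.

Lemma continuous_dotv {m : nat} (y : 'cV[R]_m) : continuous (dotv y : 'cV[R]_m -> R^o).
Proof.
move=> x; apply: (@continuous_comp _ _ _ (mulmx y^T) (fun M : 'M[R]_1 => M 0 0)).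
  exact: continuous_mulmx.
exact: coord_continuous.
Qed.

Lemma is_diff_dotv {m : nat} (y x : 'cV[R]_m) :
  is_diff x (dotv y : 'cV[R]_m -> R^o) (dotv y).
Proof.
apply: DiffDef.
  exact: (@linear_differentiable R 'cV[R]_m R^o (dotv y) x (continuous_dotv y)).
exact: (@diff_lin R 'cV[R]_m R^o (dotv y) x (continuous_dotv y)).
Qed.

Section AffinePlusInverse.
Context {U V : normedModType R} (l : U -> R^o) (u0 : R) (e : V).
Hypothesis diff_l : forall x, is_diff x l l.

(** A family stable under directional derivatives, with [l], [u0] and [e] fixed. It is used for maps
    [A] that, like [l], are their own differential everywhere, that is, linear and continuous. *)
Definition affine_plus_inverse (p : V) (A : U -> V) (r : R) (k : nat) : U -> V :=
  fun x => p + A x + (r * (u0 + l x) ^- k) *: e.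

Let aff : U -> R := fun x => u0 + l x.

Lemma differentiable_aff_exp k x : aff x != 0 -> differentiable (fun y => aff y ^- k) x.
Proof.
move=> Wx.
have daff : differentiable aff x by apply: (@differentiableD _ _ _ (cst u0) l).
case: k => [|k].
  rewrite (_ : (fun _ => _) = cst 1); first exact: differentiable_cst.
  by apply/funext => y; rewrite expr0 invr1.
apply: differentiableV; last by rewrite expf_neq0.
by have := @differentiableX _ _ aff k x daff; rewrite exprfctE.
Qed.

Lemma derive_aff_exp k x v : u0 + l x != 0 ->
  'D_v (fun y => (u0 + l y) ^- k) x = - (l v *+ k) * (u0 + l x) ^- k.+1.
Proof.
move=> Wx.
have daff : differentiable aff x by apply: (@differentiableD _ _ _ (cst u0) l).
have Daff : 'D_v aff x = l v.
  rewrite [LHS](@deriveD _ _ _ (cst u0) l); [|exact: diff_derivable|exact: diff_derivable].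
  by rewrite derive_cst add0r deriveE ?diff_val.
case: k => [|k].
  rewrite (_ : (fun _ => _) = cst 1); first by rewrite derive_cst oppr0 mul0r.
  by apply/funext => y; rewrite expr0 invr1.
have -> : (fun y => (u0 + l y) ^- k.+1) = (fun y => ((aff ^+ k.+1) y)^-1).
  by rewrite exprfctE.
have derX : derivable (aff ^+ k.+1) x v by apply: derivableX; exact: diff_derivable.
have WX : (aff ^+ k.+1) x != 0 by rewrite exprfctE expf_neq0.
rewrite (deriveV WX derX).
rewrite (deriveX _ (diff_derivable daff)).
rewrite Daff exprfctE.
rewrite /GRing.scale /= /aff -mulr_natl !exprS.
have := expf_neq0 k Wx; set y := u0 + l x in Wx *; set w := y ^+ k => w0.
by field; apply/andP.
Qed.

Lemma differentiable_affine_plus_inverse p A r k x :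
  (forall y, is_diff y A A) -> u0 + l x != 0 ->
  differentiable (affine_plus_inverse p A r k) x.
Proof.
move=> diff_A Wx.
apply: (@differentiableD _ _ _ (fun y => p + A y) (fun y => (r * aff y ^- k) *: e)).
  by apply: (@differentiableD _ _ _ (cst p) A).
apply: differentiableZl.
apply: (@differentiableZ _ _ _ (fun y => aff y ^- k : R^o) r).
exact: differentiable_aff_exp.
Qed.

Lemma derive_affine_plus_inverse p A r k x v :
  (forall y, is_diff y A A) -> u0 + l x != 0 ->
  'D_v (affine_plus_inverse p A r k) x =
  affine_plus_inverse (A v) (cst 0) (- (r * l v *+ k)) k.+1 x.
Proof.
move=> diff_A Wx.
have dinv := differentiable_aff_exp k x Wx.
have drinv : differentiable (fun y => r * aff y ^- k : R^o) x.
  exact: (@differentiableZ _ _ _ (fun y => aff y ^- k : R^o) r).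
have dA : 'D_v A x = A v by rewrite deriveE ?diff_val.
have dpA : differentiable (fun y => p + A y) x.
  by apply: (@differentiableD _ _ _ (cst p) A).
rewrite [LHS](@deriveD _ _ _ (fun y => p + A y) (fun y => (r * aff y ^- k) *: e));
  [|exact: diff_derivable|exact/diff_derivable/differentiableZl].
rewrite [X in X + _](@deriveD _ _ _ (cst p) A); [|exact: diff_derivable|exact: diff_derivable].
rewrite derive_cst add0r dA deriveE; last exact: differentiableZl.
rewrite diffZl // -deriveE //.
rewrite (@deriveZ _ _ _ (fun y => aff y ^- k : R^o) r); last exact: diff_derivable.
rewrite derive_aff_exp // /affine_plus_inverse /= addr0.
by rewrite -[r *: _]/(r * _) mulrA mulrN mulrnAr.
Qed.

(** By induction every iterated derivative is again in the family wherever the denominator is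
    nonzero, and all members are differentiable there. *)
Lemma smooth_affine_plus_inverse p A r k : (forall y, is_diff y A A) ->
  smooth_on [set x | u0 + l x != 0] (affine_plus_inverse p A r k).
Proof.
move=> diff_A.
have cont_l : continuous l.
  by move=> x; apply: differentiable_continuous; exact: ex_diff.
have openW : open [set x | u0 + l x != 0].
  apply: (@open_comp _ _ (fun x => u0 + l x) [set t : R | t != 0]) => [x _|].
    by apply: cvgD; [exact: cvg_cst|exact: cont_l].
  exact: open_neq.
have main vs : exists p' A' r' k', (forall y, is_diff y A' A') /\
    forall x, u0 + l x != 0 ->
      iter_derive (affine_plus_inverse p A r k) vs x
      = affine_plus_inverse p' A' r' k' x.
  elim: vs => [|v vs [p' [A' [r' [k' [diff_A' IH]]]]]]; first by exists p, A, r, k.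
  exists (A' v), (cst 0), (- (r' * l v *+ k')), k'.+1; split.
    by move=> y; exact: is_diff_cst.
  move=> x Wx; rewrite -(derive_affine_plus_inverse p' A' r' k') //=.
  (* The formula for [vs] holds only off the zeros of the denominator, but on an open set, so it can
     be differentiated. *)
  apply: near_eq_derive; near=> y; apply: IH.
  by near: y; exact: open_nbhs_nbhs.
move=> vs x Wx; have [p' [A' [r' [k' [diff_A' iterE]]]]] := main vs.
have near_iter : \forall y \near x, affine_plus_inverse p' A' r' k' y
    = iter_derive (affine_plus_inverse p A r k) vs y.
  near=> y; apply/esym/iterE; near: y; exact: open_nbhs_nbhs.
have diff_iter := differentiable_affine_plus_inverse p' A' r' k' x diff_A' Wx.
split=> [|v]; last first.
  apply: (@near_eq_derivable _ _ _ (affine_plus_inverse p' A' r' k')) => //.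
  exact: diff_derivable.
have := differentiable_continuous diff_iter.
rewrite /prop_for /continuous_at -(nbhs_singleton near_iter).
by apply: cvg_trans; exact: near_eq_cvg.
Unshelve. all: by end_near. Qed.

End AffinePlusInverse.
End Smooth.

(** * Local charts of the level sets *)

Section Frame.
Context {R : realType} {K : nat}.
Local Notation ones := (const_mx 1 : 'cV[R]_K).
Implicit Types q nu x : 'cV[R]_K.

Lemma mul_rows_eq0 q nu x :
  col_mx q^T nu^T *m x = 0 <-> dotv q x = 0 /\ dotv nu x = 0.
Proof.
rewrite mul_col_mx /dotv; split=> [/eqP|[qx nux]].
  by rewrite col_mx_eq0 => /andP[/eqP -> /eqP ->]; rewrite mxE.
rewrite [q^T *m x]mx11_scalar [nu^T *m x]mx11_scalar qx nux.
by rewrite !raddf0 col_mx0.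
Qed.

(** A row outside the row space of [A] is not killed by the cokernel matrix; some column of that
    matrix, rescaled, is [e]. *)
Lemma separating_vector {m : nat} (A : 'M[R]_(m, K)) nu :
  ~~ (nu^T <= A)%MS -> exists2 e : 'cV[R]_K, A *m e = 0 & dotv nu e = 1.
Proof.
rewrite submxE => /matrix0Pn[i [j Cij]].
have AC : A *m col j (cokermx A) = 0.
  by rewrite colE mulmxA mulmx_coker mul0mx.
have nuC : dotv nu (col j (cokermx A)) = (nu^T *m cokermx A) i j.
  by rewrite /dotv colE mulmxA -colE mxE (ord1 i).
exists (((nu^T *m cokermx A) i j)^-1 *: col j (cokermx A)).
  by rewrite -scalemxAr AC scaler0.
by rewrite dotvZ nuC mulVf.
Qed.

(** [B] parametrizes the future tangent space, [e] is transverse to it inside the kernel of [ones],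
    and [P] is the projection along [e]. The final alternative ensures that a correction along [e]
    will not change [q]. *)
Lemma level_frame q nu : nu \notin <[ones]>%VS -> ones != 0 ->
  exists (B : 'M[R]_(K, K - 2)) (P : 'M[R]_(K - 2, K)) (e : 'cV[R]_K),
    [/\ P *m B = 1%:M, P *m e = 0,
        forall w : 'cV[R]_(K - 2), dotv ones (B *m w) = 0 /\ dotv nu (B *m w) = 0,
        forall x, dotv ones x = 0 -> x = B *m (P *m x) + dotv nu x *: e &
        [/\ dotv ones e = 0, dotv nu e = 1 &
          dotv q e = 0 \/ forall w : 'cV[R]_(K - 2), dotv q (B *m w) = 0]].
Proof.
move=> nu1 ones0.
have rk : \rank (col_mx ones^T nu^T) = 2%N.
  apply/eqP; rewrite -[_ == _]/(row_free _); apply/inj_row_free => r.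
  rewrite -[r]hsubmxK mul_row_col [lsubmx r]mx11_scalar [rsubmx r]mx11_scalar.
  rewrite !mul_scalar_mx; set t0 := lsubmx r 0 0; set t1 := rsubmx r 0 0.
  rewrite -!linearZ -linearD /= => /(congr1 trmx); rewrite trmxK trmx0 => tt.
  have t1_0 : t1 = 0.
    apply: contraNeq nu1 => t1_neq0; apply/vlineP; exists (- t0 / t1).
    apply: (scalerI t1_neq0); rewrite scalerA mulrCA divff // mulr1 scaleNr.
    by apply/eqP; rewrite -addr_eq0 addrC tt.
  move: tt; rewrite t1_0 scale0r addr0 => /eqP.
  rewrite scaler_eq0 (negbTE ones0) orbF => /eqP ->.
  by rewrite raddf0 row_mx0.
have := ker_basis_mx (col_mx ones^T nu^T); rewrite rk => -[B [P0 [AB PB BP]]].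
have BN w : dotv ones (B *m w) = 0 /\ dotv nu (B *m w) = 0.
  by apply/mul_rows_eq0; rewrite mulmxA AB mul0mx.
have [e [e1 nue qe]] : exists e : 'cV[R]_K, [/\ dotv ones e = 0, dotv nu e = 1 &
    dotv q e = 0 \/ forall w : 'cV[R]_(K - 2), dotv q (B *m w) = 0].
  (* If [nu] is a combination of [ones] and [q], the coefficient of [q] is nonzero, so [q] vanishes
     wherever [ones] and [nu] do. *)
  have [/submxP[D nuD]|] := boolP (nu^T <= col_mx ones^T q^T)%MS; last first.
    by move=> /separating_vector[e /mul_rows_eq0[e1 qe] nue]; exists e; split=> //; left.
  have nuE : nu = lsubmx D 0 0 *: ones + rsubmx D 0 0 *: q.
    apply: trmx_inj; rewrite nuD -{1}[D]hsubmxK mul_row_col.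
    rewrite [lsubmx D]mx11_scalar [rsubmx D]mx11_scalar !mul_scalar_mx.
    by rewrite linearD !linearZ /= !mxE !mulr1n.
  have [e /= e1 nue] : exists2 e : 'cV[R]_K, ones^T *m e = 0 & dotv nu e = 1.
    apply: separating_vector; apply: contra nu1 => /sub_rVP[t nut].
    by apply/vlineP; exists t; apply: trmx_inj; rewrite nut linearZ.
  exists e; split=> //; first by rewrite /dotv e1 mxE.
  right=> w; have [w1] := BN w; rewrite nuE dotvDl !dotvZl w1 mulr0 add0r.
  move=> /eqP; rewrite mulf_eq0 => /orP[/eqP D0|/eqP//].
  have : nu \in <[ones]>%VS by apply/vlineP; exists (lsubmx D 0 0); rewrite {1}nuE D0 scale0r addr0.
  by rewrite (negbTE nu1).
(* The correction makes the projection kill [e] and leaves it unchanged on the kernel of [nu]. *)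
exists B, (P0 - P0 *m e *m nu^T), e; split=> //.
- rewrite mulmxBl PB -[_ *m nu^T *m B]mulmxA.
  have -> : nu^T *m B = 0.
    by move: AB => /eqP; rewrite mul_col_mx col_mx_eq0 => /andP[_ /eqP].
  by rewrite mulmx0 subr0.
- rewrite mulmxBl -[_ *m nu^T *m e]mulmxA [nu^T *m e]mx11_scalar.
  by rewrite -/(dotv nu e) nue mulmx1 subrr.
- move=> x x1; rewrite mulmxBl -[_ *m nu^T *m x]mulmxA [nu^T *m x]mx11_scalar.
  rewrite -/(dotv nu x) mul_mx_scalar scalemxAr -mulmxBr BP ?subrK //.
  by apply/mul_rows_eq0; rewrite !dotvB !dotvZ x1 e1 nue mulr0 mulr1 !subrr.
Qed.

End Frame.

(** Clearing denominators in [t = rem (t m)] gives a quadratic equation with the root [t = 0] split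
    off. *)
Lemma remainder_quadratic {F : fieldType} (k u m t : F) :
  u != 0 -> u + t * m != 0 ->
  t * (u ^+ 2 * (u + t * m) + k * m ^+ 2 * t) =
  (t - - k * ((u + t * m)^-1 - u^-1 + t * m / u ^+ 2)) * (u ^+ 2 * (u + t * m)).
Proof. by move=> u0 um0; field; rewrite u0 um0. Qed.

Lemma derive_dotv_curve {R : realType} {K : nat} (g : R^o -> 'cV[R]_K) (y : 'cV[R]_K) :
  derivable g 0 1 ->
  is_derive (0 : R^o) 1 (fun t => dotv y (g t) : R^o) (dotv y (derive1 g 0)).
Proof.
move=> /derivable1_diffP dg.
have dy : differentiable (dotv y : _ -> R^o) (g 0).
  by have := is_diff_dotv y (g 0).
have dyg : differentiable (fun t => dotv y (g t) : R^o) 0.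
  exact: (@differentiable_comp _ _ _ _ g (dotv y : _ -> R^o)).
apply: DeriveDef; first exact: diff_derivable.
rewrite deriveE // derive1E deriveE //.
rewrite [X in X 1](@diff_comp _ _ _ _ g (dotv y : _ -> R^o)) //=.
by have -> := @diff_val _ _ _ _ _ _ _ (is_diff_dotv y (g 0)).
Qed.

(** * The explicit chart around a point and the tangent space there *)

Section LevelManifold.
Context {R : realType} {K : nat} (a b c : R) (q s th : 'cV[R]_K).
Hypotheses (b_neq0 : b != 0) (th_relint : relint_simplex th)
  (th_dom : score_dom q th).
Local Notation ones := (const_mx 1 : 'cV[R]_K).

Let u0 := dotv q th.
Let v := score a b c q s th.
Let k := a / b.
(** The derivative of [level_fun a b c v] at [u0]; [rem] below is the remainder of its first-order
    expansion there. *)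
Let slope := k * (u0 ^- 2 - 1) - (v - c) / b.
Let nu := s - slope *: q.
Let rem (x : R) : R := - k * ((u0 + x)^-1 - u0^-1 + x / u0 ^+ 2).

Let u0_gt0 : 0 < u0. Proof. by have [_ /andP[]] := th_dom. Qed.
Let u0_neq0 : u0 != 0. Proof. by rewrite gt_eqF. Qed.
Let u01_neq0 : 1 - u0 != 0.
Proof. by rewrite subr_eq0 gt_eqF //; have [_ /andP[]] := th_dom. Qed.

Let rem0 : rem 0 = 0.
Proof. by rewrite /rem; field. Qed.

(** Implicit differentiation of [g(u, h(u)) = v] gives [h' = - g_e / g_sigma], and
    [g_sigma = b / (1 - u0)] factors out. *)
Lemma gradient_normal :
  gscore_e a b c (dotv q th) (dotv s th) *: q
    + gscore_sigma a b c (dotv q th) (dotv s th) *: s = (b / (1 - u0)) *: nu.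
Proof.
have [_ u01] := th_dom.
rewrite gscore_eE // gscore_sigmaE /nu scalerBr scalerA -/u0 addrC; congr (_ + _).
rewrite -scaleNr; congr (_ *: _).
rewrite /slope /k /v /score /gscore -/u0.
by field; rewrite b_neq0 u0_neq0 u01_neq0.
Qed.

Lemma score_level_rem x : 0 < dotv q x < 1 ->
  score a b c q s x = v <-> dotv nu (x - th) = rem (dotv q (x - th)).
Proof.
move=> x01; have [_ th01] := th_dom.
have x_neq0 : dotv q x != 0 by have /andP[/gt_eqF->] := x01.
have sth : dotv s th = level_fun a b c v u0 by apply/(gscore_level a b c v).
rewrite /score (gscore_level a b c v) // /nu.
have -> : dotv (s - slope *: q) (x - th) = dotv s x - dotv s th - slope * dotv q (x - th).
  by rewrite -scaleNr dotvDl dotvZl dotvB mulNr.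
have -> : rem (dotv q (x - th))
    = level_fun a b c v (dotv q x) - level_fun a b c v u0 - slope * dotv q (x - th).
  rewrite dotvB -/u0 /rem /level_fun /slope /k subrKC.
  by field; rewrite b_neq0 u0_neq0 x_neq0.
rewrite sth; split=> [->//|/addIr/addIr//].
Qed.

Variables (B : 'M[R]_(K, K - 2)) (P : 'M[R]_(K - 2, K)) (e : 'cV[R]_K).
Hypotheses (PB : P *m B = 1%:M) (Pe : P *m e = 0).
Hypothesis BN : forall w : 'cV[R]_(K - 2),
  dotv ones (B *m w) = 0 /\ dotv nu (B *m w) = 0.
Hypothesis BP : forall x, dotv ones x = 0 -> x = B *m (P *m x) + dotv nu x *: e.
Hypotheses (e1 : dotv ones e = 0) (nue : dotv nu e = 1).
Hypothesis qe : dotv q e = 0 \/ forall w : 'cV[R]_(K - 2), dotv q (B *m w) = 0.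

Let l : 'cV[R]_(K - 2) -> R^o := dotv (B^T *m q).
(** The chart is [th + B w + rem (l w) e]. The linear part of [rem] is absorbed in [B'] and its
    constant in the base point, which leaves a member of the smooth family. *)
Let B' : 'M[R]_(K, K - 2) := B - (k / u0 ^+ 2) *: (e *m (B^T *m q)^T).
Let chart := affine_plus_inverse l u0 e (th + (k / u0) *: e) (mulmx B') (- k) 1.
Let cochart : 'cV[R]_K -> 'cV[R]_(K - 2) :=
  affine_plus_inverse (cst 0) 1 0 (- (P *m th)) (mulmx P) 0 0.

(* When [q] does not vanish on [e], the equation of the level set along [e] is
   quadratic; the last constraint excludes its second root. *)
Let U : set 'cV[R]_K := [set x : 'cV[R]_K | (forall i, 0 < x i 0) /\
  (0 < dotv q x < 1 /\
   0 < u0 ^+ 2 * dotv q x + k * dotv q e ^+ 2 * dotv nu (x - th))].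

Let lE w : l w = dotv q (B *m w).
Proof. by rewrite /l /dotv trmx_mul trmxK mulmxA. Qed.

Let chartE w : chart w = th + B *m w + rem (l w) *: e.
Proof.
rewrite /chart /affine_plus_inverse expr1 /B' mulmxBl -scalemxAl -mulmxA.
rewrite [_^T *m w]mx11_scalar -/(dotv _ w) -/(l w) mul_mx_scalar.
by apply/colP => i; rewrite !mxE /rem; ring.
Qed.

Let chartB w : chart w - th = B *m w + rem (l w) *: e.
Proof. by rewrite chartE -[th + _ + _]addrA addrAC subrr add0r. Qed.

Let cochartE x : cochart x = P *m (x - th).
Proof.
by rewrite /cochart /affine_plus_inverse mul0r scale0r addr0 mulmxBr addrC.
Qed.

(** Either [q] vanishes on [e], or [l w = 0] and the correction [rem 0] is zero. No condition on the
    denominator enters, so membership of [chart w] in [U] will itself show that it is nonzero. *)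
Let q_chart w : dotv q (chart w) = u0 + l w.
Proof.
rewrite chartE !dotvD dotvZ -lE; case: qe => [->|qB]; first by rewrite mulr0 addr0.
by rewrite lE qB rem0 mul0r addr0.
Qed.

Let cochartK w : cochart (chart w) = w.
Proof.
rewrite cochartE chartB mulmxDr mulmxA PB mul1mx.
by rewrite -scalemxAr Pe scaler0 addr0.
Qed.

Let open_U : open U.
Proof.
have nearU (y : 'cV[R]_K) (t : R) x : t < dotv y x -> \forall z \near x, t < dotv y z.
  move=> tyx; apply: (@continuous_dotv R K y x [set z | t < z]).
  by apply: open_nbhs_nbhs; split=> //; exact: open_gt.
rewrite openE => x [xpos [/andP[qx0 qx1] tx]]; rewrite /interior /U /=.
have dotv_i i (z : 'cV[R]_K) : dotv (delta_mx i 0) z = z i 0.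
  rewrite dotvE (bigD1 i) //= big1 ?addr0 => [|j ji]; first by rewrite mxE !eqxx mul1r.
  by rewrite mxE (negbTE ji) mul0r.
have nearpos : \forall z \near x, forall i, 0 < (z : 'cV[R]_K) i 0.
  refine (@filter_forall _ 'I_K (fun i (z : 'cV[R]_K) => 0 < z i 0) (nbhs x)
    (nbhs_filter x) _) => i.
  have := nearU (delta_mx i 0) 0 x.
  rewrite dotv_i => /(_ (xpos i)); apply: filterS => z.
  by rewrite dotv_i.
have nearq0 := nearU q 0 x qx0.
have dotvN (z : 'cV[R]_K) : dotv (- q) z = - dotv q z.
  by rewrite -scaleN1r dotvZl mulN1r.
have nearq1 : \forall z \near x, - 1 < dotv (- q) z.
  by apply: nearU; rewrite dotvN ltrN2.
(* The last constraint of [U] is affine in the point, with linear part [dotv y]. *)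
pose y := u0 ^+ 2 *: q + (k * dotv q e ^+ 2) *: nu.
have yE z : u0 ^+ 2 * dotv q z + k * dotv q e ^+ 2 * dotv nu (z - th)
    = dotv y z - k * dotv q e ^+ 2 * dotv nu th.
  by rewrite dotvB (dotvDl z (u0 ^+ 2 *: q)) !dotvZl; ring.
have neart : \forall z \near x, k * dotv q e ^+ 2 * dotv nu th < dotv y z.
  by apply: nearU; rewrite -subr_gt0 -yE.
near=> z; split; first by near: z.
split; last by rewrite yE subr_gt0; near: z.
apply/andP; split; first by near: z.
by rewrite -ltrN2 -dotvN; near: z.
Unshelve. all: by end_near. Qed.

Let th_U : U th.
Proof.
have [_ thpos] := th_relint; have [_ th01] := th_dom.
by split=> //; split=> //; rewrite subrr dotv0 mulr0 addr0 mulr_gt0 // exprn_gt0.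
Qed.

Let diff_l x : is_diff x l l. Proof. exact: is_diff_dotv. Qed.

Let smooth_chart : smooth_on [set w | u0 + l w != 0] chart.
Proof. by apply: smooth_affine_plus_inverse => // y; exact: is_diff_mulmx. Qed.

Let smooth_cochart : smooth_on U cochart.
Proof.
have diff0 (x : 'cV[R]_K) : is_diff x (cst 0 : 'cV[R]_K -> R^o) (cst 0).
  exact: is_diff_cst.
have smooth_all := @smooth_affine_plus_inverse R _ _ _ 1 (0 : 'cV[R]_(K - 2))
  diff0 (- (P *m th)) (mulmx P) 0 0 (is_diff_mulmx P).
by move=> vs x _; apply: smooth_all; rewrite /= addr0 oner_neq0.
Qed.

Let chart_dom w : U (chart w) -> u0 + l w != 0.
Proof. by move=> [_ [/andP[+ _] _]]; rewrite q_chart => /gt_eqF->. Qed.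

Let open_chart_dom : open (chart @^-1` U).
Proof.
rewrite openE => w Uw; have [cont _] := smooth_chart [::] w (chart_dom w Uw).
by apply: (cont U); exact: open_nbhs_nbhs.
Qed.

(** In the frame, [x - th] has coordinates [w = P (x - th)] and [nu . (x - th)] along [e]; the level
    equation has to force the latter to be [rem (l w)]. *)
Let level_chartP x : (score_level a b c q s v `&` U) x <-> exists2 w, U (chart w) & chart w = x.
Proof.
have th1 : dotv ones th = 1 by rewrite dotv1E; have [[]] := th_dom.
split=> [[[[simx qx] scx] Ux]|[w Uw <-]]; last first.
  have [pos [q01 _]] := Uw; split=> //; split.
    split=> //; split=> [i|]; first exact/ltW/pos.
    by rewrite -dotv1E chartE !dotvD dotvZ e1 mulr0 addr0 th1 (BN w).1 addr0.
  have qE : dotv q (chart w - th) = l w by rewrite dotvB q_chart -/u0 addrC addKr.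
  apply/score_level_rem => //; rewrite qE.
  by rewrite chartB dotvD dotvZ (BN w).2 add0r nue mulr1.
have x1 : dotv ones (x - th) = 0 by rewrite dotvB th1 dotv1E simx.2 subrr.
have xE := BP _ x1.
have nux := (score_level_rem x qx).1 scx.
set w := P *m (x - th) in xE.
suff xw : chart w = x by exists w; rewrite ?xw.
suff remE : rem (l w) = dotv nu (x - th).
  by rewrite chartE remE -addrA -xE addrC subrK.
have qxE : dotv q (x - th) = l w + dotv nu (x - th) * dotv q e.
  by rewrite [LHS](congr1 (dotv q) xE) [LHS]dotvD dotvZ lE.
case: qe => [qe0|qB]; first by rewrite nux qxE qe0 mulr0 addr0.
(* Here [l w = 0], so the coordinate [t] along [e] must be shown to vanish; the other root of its
   equation is excluded by [U]. *)
move: qxE; rewrite lE qB add0r rem0 => qxE; apply/esym.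
have qx_neq0 : dotv q x != 0 by have /andP[/gt_eqF->] := qx.
set t := dotv nu (x - th) in nux qxE *.
have qxu : dotv q x = u0 + t * dotv q e by rewrite -qxE dotvB subrKC.
have : t * (u0 ^+ 2 * dotv q x + k * dotv q e ^+ 2 * t) = 0.
  move: nux; rewrite qxE /rem -qxu -/t => nux.
  rewrite qxu in qx_neq0 nux *.
  by rewrite remainder_quadratic // -nux subrr mul0r.
by move=> /eqP; rewrite mulf_eq0 => /orP[/eqP//|]; rewrite gt_eqF //; exact: Ux.2.2.
Qed.

Lemma level_submanifold : smooth_submanifold (K - 2) (score_level a b c q s v `&` U).
Proof.
move=> x [_ Ux]; exists (chart @^-1` U), U, chart, cochart; split; split=> //.
- by move=> vs w Uw; apply: smooth_chart; exact: chart_dom.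
- apply/seteqP; split=> y.
    by move=> [w Uw cw]; split; [apply/level_chartP; exists w|rewrite -cw].
  by move=> [/level_chartP[w Uw cw] _]; exists w.
Qed.

(** A curve on the level set satisfies [nu . (g - th) = rem (q . (g - th))], and [rem] has zero
    derivative at [0]. Conversely, the chart carries a line through [0] to a curve with the
    prescribed velocity. *)
Lemma level_tangent_space : tangent_space (score_level a b c q s v `&` U) th =
  [set d | dotv ones d = 0 /\ dotv nu d = 0].
Proof.
apply/seteqP; split=> d.
  move=> [I [g [[openI I0 smooth_g gM] [g0 <-]]]].
  have [_ /(_ 1) dg] := smooth_g [::] 0 I0; rewrite /= in dg.
  have nearI : \forall t \near (0 : R^o), I t by exact: open_nbhs_nbhs.
  split.
    have near1 : \forall t \near (0 : R^o), dotv ones (g t) = cst (1 : R^o) t.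
      near=> t; have /gM[[[[_ gt1] _] _] _] : I t by near: t.
      by rewrite dotv1E gt1.
    have [_ <-] := derive_dotv_curve g ones dg.
    by rewrite (near_eq_derive _ near1) derive_cst.
  have dnu := derive_dotv_curve g nu dg.
  have dq := derive_dotv_curve g q dg.
  (* The level equation with [rem] expanded in powers of [q . g(t)]; at [t = 0] the derivatives of
     the two varying terms cancel. *)
  pose f (t : R^o) : R^o := (dotv nu th + k / u0 + k / u0 : R^o)
       + ((- k) *: ((dotv q (g t))^-1 : R^o)
          + (- k / u0 ^+ 2) *: (dotv q (g t) : R^o)).
  have nearf : \forall t \near (0 : R^o), dotv nu (g t) = f t.
    near=> t; have /gM[[[_ gt01] gtv] _] : I t by near: t.
    have := (score_level_rem (g t) gt01).1 gtv.
    rewrite dotvB => /eqP; rewrite subr_eq addrC => /eqP ->.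
    rewrite /rem dotvB -/u0 subrKC /f /GRing.scale /=.
    have gt_neq0 : dotv q (g t) != 0 by have /andP[/gt_eqF->] := gt01.
    move: (dotv q (g t)) gt_neq0 => y y0.
    by field; rewrite u0_neq0.
  have [_ <-] := dnu; rewrite (near_eq_derive _ nearf) /f.
  have qg0 : dotv q (g 0) != 0 by rewrite g0.
  have dqV := is_deriveV qg0 dq.
  rewrite derive_val g0 /GRing.scale /= -/u0.
  by field; rewrite u0_neq0.
move=> [d1 nud]; set w := P *m d.
have dE : B *m w = d by rewrite [RHS](BP _ d1) nud scale0r addr0.
(* Restricted to a line, the chart is again in the smooth family, now in a real variable. *)
have curveE : (fun t : R^o => chart (t *: w)) =
    affine_plus_inverse (fun t : R^o => t *: (l w : R^o)) u0 e (th + (k / u0) *: e)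
      (fun t : R^o => t *: (B' *m w)) (- k) 1.
  apply/funext => t; rewrite /chart /affine_plus_inverse -scalemxAr.
  by rewrite /l dotvZ.
have diff_lw (t : R^o) : is_diff t (fun t : R^o => t *: (l w : R^o)) ( *:%R ^~ (l w)).
  exact: is_diff_scalel.
have diff_Bw (t : R^o) : is_diff t (fun t : R^o => t *: (B' *m w)) ( *:%R ^~ (B' *m w)).
  exact: is_diff_scalel.
have smooth_curve := @smooth_affine_plus_inverse R R^o _ _ u0 e diff_lw
  (th + (k / u0) *: e) _ (- k) 1 diff_Bw.
have curve0 : chart (0 *: w) = th.
  by rewrite scale0r chartE mulmx0 addr0 /l dotv0 rem0 scale0r addr0.
exists [set t | U (chart (t *: w))], (fun t => chart (t *: w)); split; first split.
- apply: (@open_comp _ _ (fun t : R^o => t *: w) (chart @^-1` U)) => // t _.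
  by apply: differentiable_continuous; have := is_diff_scalel t w.
- by rewrite /= curve0.
- rewrite curveE => vs t Ut; apply: smooth_curve.
  by have := chart_dom _ Ut; rewrite /= /l dotvZ.
- by move=> t Ut; apply/level_chartP; exists (t *: w).
split=> //.
have dom0 : u0 + (0 : R) *: (l w : R^o) != 0 by rewrite scale0r addr0.
rewrite derive1E curveE.
rewrite (@derive_affine_plus_inverse R R^o _ _ u0 e diff_lw _ _ _ _ _ _ diff_Bw dom0).
(* The velocity is [B' w + (k / u0^2) (l w) e], which is [B w = d]. *)
rewrite /affine_plus_inverse !scale1r scale0r !addr0 -dE /B' mulmxBl -scalemxAl -mulmxA.
rewrite [_^T *m w]mx11_scalar -/(dotv _ w) -/(l w) mul_mx_scalar.
by apply/colP => i; rewrite !mxE mulr1n; ring.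
Unshelve. all: by end_near.
Qed.

Lemma level_chart : exists U : set 'cV[R]_K,
  [/\ open U, U th, smooth_submanifold (K - 2) (score_level a b c q s v `&` U) &
      tangent_space (score_level a b c q s v `&` U) th =
        [set d | dotv ones d = 0 /\ dotv nu d = 0]].
Proof.
exists U; split; [exact: open_U|exact: th_U|exact: level_submanifold|].
exact: level_tangent_space.
Qed.

End LevelManifold.

(** The gradient [n] is a nonzero multiple of [nu], so not being in the span of [ones], and
    orthogonality, carry over from one to the other. *)
Lemma score_level_manifold {R : realType} {K : nat} (a b c : R)
    (q s th : 'cV[R]_K) : b != 0 -> relint_simplex th -> score_dom q th ->
  let n := gscore_e a b c (dotv q th) (dotv s th) *: q
           + gscore_sigma a b c (dotv q th) (dotv s th) *: s in
  n \notin <[const_mx 1 : 'cV[R]_K]>%VS ->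
  exists U : set 'cV[R]_K,
    let M := score_level a b c q s (score a b c q s th) `&` U in
    [/\ open U, U th, smooth_submanifold (K - 2) M &
        tangent_space M th =
          [set delta | dotv (const_mx 1) delta = 0 /\ dotv n delta = 0]].
Proof.
move=> b0 th_relint th_dom n.
have nE : n = _ := gradient_normal a b c q s th b0 th_dom.
set nu := (X in _ *: X) in nE.
have r0 : b / (1 - dotv q th) != 0.
  rewrite mulf_neq0 // invr_eq0 subr_eq0 gt_eqF //.
  by have [_ /andP[]] := th_dom.
move=> n1.
have nu1 : nu \notin <[const_mx 1 : 'cV[R]_K]>%VS.
  by apply: contra n1 => nu1; rewrite nE rpredZ.
have ones0 : (const_mx 1 : 'cV[R]_K) != 0.
  apply: contraTneq (oner_neq0 R) => ones0; rewrite negbK.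
  have [[_ th1] _] := th_relint.
  by rewrite -th1 -dotv1E ones0 /dotv trmx0 mul0mx mxE.
have [B [P [e [PB Pe BN BP [e1 nue qe]]]]] := level_frame q nu nu1 ones0.
have [U [oU thU sub tan]] :=
  level_chart a b c q s th b0 th_relint th_dom B P e PB Pe BN BP e1 nue qe.
exists U; split=> //.
rewrite tan; apply/seteqP; split=> d [d1 dn]; split=> //.
  by rewrite nE dotvZl dn mulr0.
by move: dn => /eqP; rewrite nE dotvZl mulf_eq0 (negbTE r0) => /eqP.
Qed.

Theorem proposition7 (R : realType) (V : finType) (smax : R) (syl : V -> R)
    (hsyl : forall w, 1 <= syl w <= smax)
    (K : nat) (beta : 'I_K -> option V -> R)
    (hbeta : forall k, is_dist (beta k))
    (a b c : R) (habc : (a, b, c) = fkgl_coefs \/ (a, b, c) = fre_coefs) :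
  let q := stop_vec beta in
  let s := syl_vec syl beta in
  let Phi := score a b c q s in
  let rho := \rank (moment_matrix q s) in
  (* (i) *)
  (forall u z : R, 0 < u < 1 -> fibre q s u z !=set0 ->
    [/\ polytope (fibre q s u z),
        constant_on Phi (fibre q s u z),
        (exists2 d : nat, (d <= K - rho)%N &
           affine_subspace_of_dim d (aff_hull (fibre q s u z))) &
        fibre q s u z `&` relint_simplex !=set0 ->
          affine_subspace_of_dim (K - rho) (aff_hull (fibre q s u z))])
  /\
  (* (ii) *)
  (forall theta : 'cV[R]_K, relint_simplex theta -> score_dom q theta ->
    let n := gscore_e a b c (dotv q theta) (dotv s theta) *: q
             + gscore_sigma a b c (dotv q theta) (dotv s theta) *: s in
    n \notin <[const_mx 1 : 'cV[R]_K]>%VS ->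
    exists U : set 'cV[R]_K,
      let M := score_level a b c q s (Phi theta) `&` U in
      [/\ open U, U theta, smooth_submanifold (K - 2) M &
          tangent_space M theta =
            [set delta | dotv (const_mx 1) delta = 0 /\ dotv n delta = 0]])
  /\
  (* (iii) *)
  (rho = 3%N ->
    (forall C : set 'cV[R]_K,
       convex_set C -> C `<=` score_dom q -> constant_on Phi C ->
       [/\ convex_set (moments q s @` C),
           (exists2 v : R, moments q s @` C `<=` level_curve a b c v &
              strictly_concave_graph `]0, 1[ (level_curve a b c v)),
           is_subset1 (moments q s @` C) &
           exists u z : R, C `<=` fibre q s u z])
    /\
    (forall (v : R) (x y : 'cV[R]_K),
       segment_set x y `<=` score_level a b c q s v ->
       constant_on (moments q s) (segment_set x y))).
Proof.
move=> q s Phi rho.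
(* In both scores [a] and [b] have the same sign: both positive for the first, both negative for the
   second. *)
have ab_gt0 : 0 < a / b.
  case: habc => -[-> -> _]; last rewrite invrN mulrNN.
    by apply: divr_gt0; apply: divr_gt0; rewrite ltr0n.
  by apply: divr_gt0; apply: divr_gt0; rewrite ltr0n.
have b_neq0 : b != 0 by apply: contraTneq ab_gt0 => ->; rewrite invr0 mulr0 ltxx.
split; [|split].
- move=> u z u01 F0; have [dimF dimFE] := fibre_aff_hull q s u z F0.
  split=> //; first exact: fibre_polytope.
  exists (gscore a b c u z) => x [_ qx sx].
  by rewrite /Phi /score qx sx.
- by move=> theta th_relint th_dom; exact: score_level_manifold.
- move=> _; split=> [C|v x y]; first exact: convex_level_set_moments.
  exact: segment_level_set_moments.
Qed.
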